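(* Let $\mathcal{P}_1$ be the set of pairs $(m,n)$ of relatively prime positive integers of opposite parity with $m>n$ and $m/n\ge 2$. Let $\{(A_{m,n},B_{m,n},C_{m,n})\}_{(m,n)\in\mathcal{P}_1}$ be a family of triples of connected graphs such that for all $(m,n)\in\mathcal{P}_1$ $$Z(A_{m,n})=m^2-n^2,\qquad Z(B_{m,n})=2mn,\qquad Z(C_{m,n})=m^2+n^2.$$ Suppose the family has a common symmetric kernel $(A^{(1)},B^{(1)},C^{(1)})$; that is, $A^{(1)},B^{(1)},C^{(1)}$ are graphs, each with a left and a right base point, and for every $(m,n)\in\mathcal{P}_1$ there is a graph $G_{m,n}$ with a base point such that $A_{m,n}=G_{m,n}\vee A^{(1)}\vee G_{m,n}$, $B_{m,n}=G_{m,n}\vee B^{(1)}\vee G_{m,n}$ and $C_{m,n}=G_{m,n}\vee C^{(1)}\vee G_{m,n}$. Then $$(A^{(1)},B^{(1)},C^{(1)})=(C(\dot1,1,\dot1),\,C(\ddot4),\,C(\dot2,\dot2))$$ as triples of graphs with left and right base points.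
   Context: Graphs are finite, undirected, without loops or multiple edges; equality of graphs (with base points) means isomorphism (respecting base points). The Hosoya index $Z(G)$ is the number of matchings of $G$ (sets of pairwise vertex-disjoint edges, including the empty set). For positive integers $a_1,\dots,a_d$, the caterpillar $C(a_1,\dots,a_d)$ has vertices $(i,j)$ with $1\le i\le d$, $1\le j\le a_i$, and edges $\{(i,1),(i,j)\}$ for $1<j\le a_i$ and $\{(i,1),(i+1,1)\}$ for $1\le i<d$. Dots mark base points: in $C(a_1,\dots,\dot a_l,\dots,\dot a_r,\dots,a_d)$ with $l<r$ the left base point is $(l,1)$ and the right base point is $(r,1)$; a double dot $\ddot a_l$ means that $(l,1)$ is both the left and the right base point. If $G$ is a graph with a base point $g$ and $S$ is a graph with left base point $l$ and right base point $r$ (possibly $l=r$), then $G\vee S\vee G$ is the graph obtained from the disjoint union of $S$ and two copies of $G$ by identifying the base point $g$ of the first copy with $l$ and the base point $g$ of the second copy with $r$ (if $l=r$ all three vertices are identified). *)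

(* Defs.v *)
From mathcomp Require Import all_boot.
Set Implicit Arguments.
Unset Strict Implicit.
Unset Printing Implicit Defensive.

Record sgraph := SGraph {
  vertex :> finType;
  edge : rel vertex;
  edge_sym : symmetric edge;
  edge_irr : irreflexive edge }.
Arguments edge {s} : rename.

Record pgraph := PGraph { pg_graph :> sgraph; base : pg_graph }.
Arguments base : clear implicits.

(* The two base points are allowed to coincide. *)
Record lrgraph := LRGraph {
  lr_graph :> sgraph; lbase : lr_graph; rbase : lr_graph }.
Arguments lbase : clear implicits.
Arguments rbase : clear implicits.

Definition is_iso (G H : sgraph) (f : G -> H) : Prop :=
  bijective f /\ forall x y : G, edge (f x) (f y) = edge x y.

Definition iso (G H : sgraph) : Prop := exists f : G -> H, is_iso f.

Definition lr_iso (S T : lrgraph) : Prop :=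
  exists f : S -> T,
    [/\ is_iso f, f (lbase S) = lbase T & f (rbase S) = rbase T].

(* This also holds of the empty graph. *)
Definition connected (G : sgraph) : Prop :=
  forall x y : G, connect (@edge G) x y.

Definition edge_set (G : sgraph) : {set {set G}} :=
  [set [set p.1; p.2] | p : G * G & edge p.1 p.2].

Definition is_matching (G : sgraph) (M : {set {set G}}) : bool :=
  (M \subset edge_set G) && trivIset M.

Definition hosoya (G : sgraph) : nat := #|[set M | @is_matching G M]|.

(* Rows and columns are numbered from 0: the vertex (i, j) of the usual
   1-based description is (i - 1, j - 1) here. *)
Section Caterpillar.
Variable a : seq nat.

Definition cat_vertex := {i : 'I_(size a) & 'I_(nth 0 a i)}.

Definition cat_arc (u v : cat_vertex) : bool :=
  [&& tag u == tag v, tagged u == 0 :> nat & 0 < tagged v] ||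
  [&& (tag u).+1 == tag v :> nat, tagged u == 0 :> nat
    & tagged v == 0 :> nat].

Definition cat_edge (u v : cat_vertex) : bool := cat_arc u v || cat_arc v u.

Lemma cat_edge_sym : symmetric cat_edge.
Proof. by move=> u v; rewrite /cat_edge orbC. Qed.

Lemma cat_edge_irr : irreflexive cat_edge.
Proof.
move=> u; rewrite /cat_edge orbb /cat_arc eqxx (gtn_eqF (ltnSn _)) orbF.
by case: (nat_of_ord (tagged u)).
Qed.

Definition cat_graph : sgraph := SGraph cat_edge_sym cat_edge_irr.

Hypothesis a_gt0 : all (leq 1) a.

Lemma cat_row_gt0 (i : 'I_(size a)) : 0 < nth 0 a i.
Proof. exact: (allP a_gt0) (mem_nth 0 (ltn_ord i)). Qed.

Definition cat_spine (i : 'I_(size a)) : cat_graph :=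
  Tagged (fun k : 'I_(size a) => 'I_(nth 0 a k)) (Ordinal (cat_row_gt0 i)).

Definition caterpillar (l r : 'I_(size a)) : lrgraph :=
  LRGraph (cat_spine l) (cat_spine r).

End Caterpillar.

(* G v S v G. The disjoint union of S and two copies of G is S + (G + G);
   glue_repr sends the base point of the first (second) copy of G to the left
   (right) base point of S and fixes everything else, so its fibres are the
   classes of the identification. A class is represented by the fixed point
   of glue_repr that it contains, and two classes are adjacent when some of
   their members are. *)
Section Glue.
Variables (G : pgraph) (S : lrgraph).

Definition glue_sum : finType := (S + (G + G))%type.

Definition sum_edge (u v : glue_sum) : bool :=
  match u, v with
  | inl x, inl y => edge x y
  | inr (inl x), inr (inl y) => edge x y
  | inr (inr x), inr (inr y) => edge x y
  | _, _ => false
  end.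

Definition glue_repr (u : glue_sum) : glue_sum :=
  match u with
  | inl _ => u
  | inr (inl x) => if x == base G then inl (lbase S) else u
  | inr (inr x) => if x == base G then inl (rbase S) else u
  end.

Definition glue_vertex := {u : glue_sum | glue_repr u == u}.

Definition glue_edge (u v : glue_vertex) : bool :=
  [exists p, exists q,
    [&& glue_repr p == val u, glue_repr q == val v & sum_edge p q]].

Lemma glue_edge_sym : symmetric glue_edge.
Proof.
have sym p q : sum_edge p q = sum_edge q p.
  by case: p q => [x|[x|x]] [y|[y|y]] //=; rewrite edge_sym.
by move=> u v; apply/existsP/existsP => -[p /existsP[q /and3P[pu qv pq]]];
  exists q; apply/existsP; exists p; rewrite pu qv sym pq.
Qed.

Lemma glue_edge_irr : irreflexive glue_edge.
Proof.
move=> u; apply/negbTE/negP.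
move=> /existsP[p /existsP[q /and3P[/eqP pu /eqP qu pq]]].
have eq_pq : p = q.
  move: pu; rewrite -{}qu.
  by case: p q pq => [x|[x|x]] [y|[y|y]] //= _;
    do ?[case: eqP => [->|_]].
by case: q pq {pu qu} eq_pq => [x|[x|x]] pq eq_pq;
  rewrite eq_pq /= edge_irr in pq.
Qed.

Definition glue : sgraph := SGraph glue_edge_sym glue_edge_irr.

End Glue.

Definition P1 (m n : nat) : Prop :=
  [/\ 0 < m, 0 < n, coprime m n & odd m != odd n] /\ (n < m /\ 2 * n <= m).

(* Only the members of the families indexed by P1 matter. *)
Definition common_symmetric_kernel (A B C : nat -> nat -> sgraph)
    (A1 B1 C1 : lrgraph) : Prop :=
  forall m n : nat, P1 m n ->
    exists G : pgraph,
      [/\ iso (A m n) (glue G A1), iso (B m n) (glue G B1)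
        & iso (C m n) (glue G C1)].

(* Main.v *)
(* Write x for the number of matchings of G avoiding its base point and y for
   the number of those covering it. Splitting a matching of G v S v G into its
   three pieces gives
     Z(G v S v G) = Z(S) x^2 + (Z(S - l) + Z(S - r)) x y + Z(S - l - r) y^2,
   where the last term is absent if l = r. The values at (m, n) = (2, 1),
   (4, 1) and (5, 2), with the trivial bounds on the coefficients, force the
   three forms to be 3x^2 + 4xy + y^2, 4x^2 + 2xy and 5x^2 + 4xy + y^2. When
   the last coefficient is 1 no edge avoids both base points, and when it is 0
   the base points coincide and every edge contains them; since the kernels
   are connected, the remaining coefficients then determine them. *)
Require Import Defs.
From mathcomp Require Import all_boot zify.
Set Implicit Arguments.
Unset Strict Implicit.
Unset Printing Implicit Defensive.

(** * Counting matchings *)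

(** [nmatch_rec] deletes one vertex or two, so the induction hypothesis has to cover every subset of
    [A :\ x]. *)
Lemma setD1_ind (T : finType) (P : {set T} -> Prop) :
  P set0 -> (forall (A : {set T}) x, x \in A ->
    (forall B : {set T}, B \subset A :\ x -> P B) -> P A) ->
  forall A, P A.
Proof.
move=> P0 PS A; have [n] := ubnP #|A|; elim: n A => // n IHn A.
have [->|[x xA]] := set_0Vmem A; first by [].
rewrite (cardsD1 x) xA ltnS => cA; apply: (PS _ x) => // B /subset_leq_card cB.
by apply: IHn; exact: leq_ltn_trans cB cA.
Qed.

Section Matchings.
Variable G : sgraph.
Implicit Types (A B U W : {set G}) (M : {set {set G}}) (v w : G).

(** This is the Hosoya index of the subgraph induced on [A], counted inside [G] so that deleting
    vertices leaves the vertex type unchanged. *)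
Definition nmatch A : nat := #|[set M | is_matching M && (cover M \subset A)]|.

Lemma matchingP M :
  reflect (M \subset edge_set G /\ trivIset M) (is_matching M).
Proof. exact: andP. Qed.

Lemma hosoyaE : hosoya G = nmatch setT.
Proof. by apply: eq_card => M; rewrite !inE subsetT andbT. Qed.

Lemma nmatch_gt0 A : 0 < nmatch A.
Proof.
apply/card_gt0P; exists set0; rewrite inE /is_matching sub0set /cover big_set0.
by rewrite sub0set andbT; apply/trivIsetP => B C; rewrite inE.
Qed.

Lemma nmatch_sub A B : A \subset B -> nmatch A <= nmatch B.
Proof.
move=> sAB; apply/subset_leq_card/subsetP => M; rewrite !inE => /andP[-> /=].
by move/subset_trans; apply.
Qed.

Lemma edge_setP (e : {set G}) :
  reflect (exists x y, edge x y /\ e = [set x; y]) (e \in edge_set G).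
Proof.
apply: (iffP imsetP) => [[[x y]]|[x [y [xy ->]]]].
  by rewrite inE /= => xy ->; exists x, y.
by exists (x, y); rewrite ?inE.
Qed.

Lemma edge_set2 v w : ([set v; w] \in edge_set G) = edge v w.
Proof.
apply/edge_setP/idP => [[x [y [xy eq_vw]]]|vw]; last by exists v, w.
have [/set2P vxy /set2P wxy] : v \in [set x; y] /\ w \in [set x; y].
  by split; rewrite -eq_vw !inE eqxx ?orbT.
have neq_xy : x != y by apply: contraTneq xy => ->; rewrite edge_irr.
have : #|[set v; w]| = 2 by rewrite eq_vw cards2 neq_xy.
rewrite cards2 => /eqP; rewrite eqSS eqb1 => neq_vw.
by case: vxy wxy neq_vw => -> [] ->; rewrite ?eqxx // edge_sym.
Qed.

Lemma nmatch_set0 : nmatch set0 = 1.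
Proof.
rewrite /nmatch (_ : [set M | _] = [set set0]) ?cards1 //.
apply/setP => M; rewrite !inE; apply/andP/eqP => [[/matchingP[/subsetP sME _] M0]|->].
  apply/setP => e; rewrite in_set0; apply: contraTF (M0) => eM.
  have /edge_setP[x [y [_ exy]]] := sME e eM.
  apply/subsetPn; exists x; rewrite ?inE //; apply/bigcupP; exists e => //.
  by rewrite exy !inE eqxx.
rewrite /is_matching sub0set /cover big_set0 sub0set; split => //.
by apply/trivIsetP => B C; rewrite inE.
Qed.

(** Adding the edge [[set v; w]] is a bijection, since a matching inside [A :\ v :\ w] cannot touch
    that edge. *)
Lemma nmatch_edge A v w : edge v w -> v \in A -> w \in A ->
  #|[set M | [&& is_matching M, cover M \subset A & [set v; w] \in M]]|
  = nmatch (A :\ v :\ w).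
Proof.
move=> vw vA wA; set e := [set v; w].
have e_neq0 : e != set0 by apply/set0Pn; exists v; rewrite !inE eqxx.
have eNin M : cover M \subset A :\ v :\ w -> e \notin M.
  apply: contraL => eM; apply/subsetPn; exists v; last by rewrite !inE eqxx andbF.
  by apply/bigcupP; exists e; rewrite // !inE eqxx.
rewrite /nmatch -[RHS](@card_in_imset _ _ (fun M => e |: M)); last first.
  move=> M N; rewrite !inE => /andP[_ /eNin eM] /andP[_ /eNin eN] eqMN.
  by rewrite -(setU1K eM) -(setU1K eN) eqMN.
apply: eq_card => M; rewrite inE; apply/idP/imsetP => [/and3P[/matchingP[sME tM] cM eM]|].
  exists (M :\ e); last by rewrite setD1K.
  rewrite inE /is_matching (subset_trans (subsetDl _ _) sME) /=.
  rewrite (trivIsetS (subsetDl _ _) tM) /=.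
  apply/subsetP => x /bigcupP[f /setD1P[f_neq fM] xf].
  have xNe : x \notin e.
    have /trivIsetP/(_ _ _ fM eM f_neq)/pred0P/(_ x)/= := tM.
    by rewrite xf /= => ->.
  move: xNe; rewrite !inE negb_or => /andP[-> ->] /=.
  by apply: (subsetP cM); apply/bigcupP; exists f.
case=> N; rewrite inE => /andP[/matchingP[sNE tN] cN] ->.
apply/and3P; split; last by rewrite setU11.
- rewrite /is_matching subUset sub1set edge_set2 vw sNE /=.
  apply/trivIsetP => f g; rewrite !in_setU1.
  have dis h : h \in N -> [disjoint e & h].
    move=> hN; rewrite disjoint_sym disjoint_subset; apply/subsetP => x xh.
    have : x \in A :\ v :\ w by apply: (subsetP cN); apply/bigcupP; exists h.
    by rewrite !inE => /and3P[/negPf-> /negPf->].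
  case/predU1P=> [->|fN] /predU1P[->|gN]; rewrite ?eqxx // => fg.
  - exact: dis.
  - by rewrite disjoint_sym dis.
  - exact: (trivIsetP tN).
- apply/subsetP => x /bigcupP[f /setU1P[->|fN] xf].
    by move: xf; rewrite !inE => /orP[/eqP->|/eqP->].
  have : x \in A :\ v :\ w by apply: (subsetP cN); apply/bigcupP; exists f.
  by rewrite !inE => /and3P[].
Qed.

(** A matching inside [A] either misses [v] or covers it by exactly one edge, whose other end [w]
    classifies it; [nmatch_edge] counts each class. *)
Lemma nmatch_rec A v : v \in A ->
  nmatch A = nmatch (A :\ v) + \sum_(w in A | edge v w) nmatch (A :\ v :\ w).
Proof.
move=> vA; pose X w := [set M | [&& is_matching M, cover M \subset A & [set v; w] \in M]].
have Xw w : w \in A -> edge v w -> nmatch (A :\ v :\ w) = #|X w|.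
  by move=> wA vw; rewrite nmatch_edge.
under eq_bigr => w /andP[wA vw] do rewrite (Xw w wA vw).
pose Y := [set M | is_matching M && (cover M \subset A)].
rewrite {1}/nmatch -/Y -(cardsID [set M : {set {set G}} | v \in cover M] Y) addnC.
congr (_ + _).
  apply: eq_card => M; rewrite !inE andbC -andbA; congr (_ && _).
  by rewrite subsetD1.
rewrite (_ : _ :&: _ = \bigcup_w X w).
  rewrite -sum1_card partition_disjoint_bigcup /=.
    rewrite [RHS]big_mkcond; apply: eq_bigr => w _; rewrite sum1_card.
    case: ifPn => // /negP wN; apply/eqP; rewrite cards_eq0; apply/eqP/setP => M.
    rewrite !inE; apply/negbTE/negP => /and3P[/matchingP[/subsetP sME _] cM wM].
    case: wN; rewrite -edge_set2 sME // andbT; apply: (subsetP cM).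
    by apply/bigcupP; exists [set v; w]; rewrite // !inE eqxx orbT.
  (* Two different edges at [v] cannot lie in one matching, so the classes are disjoint. *)
  move=> w u neq_wu; rewrite -setI_eq0; apply/eqP/setP => M.
  rewrite !inE; apply/negbTE/negP => /andP[/and3P[mM _ wM] /and3P[_ _ uM]].
  have neq : [set v; w] != [set v; u].
    apply: contra neq_wu => /eqP eq_wu.
    have: edge v w by move: mM => /matchingP[/subsetP/(_ _ wM)]; rewrite edge_set2.
    have : w \in [set v; u] by rewrite -eq_wu !inE eqxx orbT.
    by case/set2P=> ->; rewrite ?eqxx ?edge_irr.
  have /matchingP[_ /trivIsetP/(_ _ _ wM uM neq)] := mM.
  by move/pred0P/(_ v); rewrite /= !inE eqxx.
apply/setP => M; rewrite !inE; apply/idP/bigcupP.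
  case/andP=> /andP[mM cM] /bigcupP[e eM ve].
  have /edge_setP[x [y [xy exy]]] : e \in edge_set G by case/matchingP: mM => /subsetP->.
  move: ve eM; rewrite exy => /set2P[] eq_v; subst v => eM.
    by exists y => //; rewrite inE mM cM.
  by exists x => //; rewrite inE mM cM setUC.
case=> w _; rewrite inE => /and3P[-> -> vwM] /=.
by apply/bigcupP; exists [set v; w]; rewrite // !inE eqxx.
Qed.

(** Expanding both sides at a vertex [v] of [U] gives the same sum: the neighbours of [v] in the
    union all lie in [U]. *)
Lemma nmatchU U W : [disjoint U & W] ->
  (forall v w, v \in U -> w \in W -> ~~ edge v w) ->
  nmatch (U :|: W) = nmatch U * nmatch W.
Proof.
elim/setD1_ind: U => [|U v vU IHU] dUW noUW; first by rewrite set0U nmatch_set0 mul1n.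
have IH B : B \subset U :\ v -> nmatch (B :|: W) = nmatch B * nmatch W.
  move=> sBU; have sB := subset_trans sBU (subsetDl _ _).
  apply: IHU => // [|x w xB]; first exact: disjointWl dUW.
  by apply: noUW; apply: (subsetP sB).
have NW x : x \in U -> x \notin W by move=> xU; rewrite (disjointFr dUW).
have setDUW B x : x \in U -> (B :|: W) :\ x = (B :\ x) :|: W.
  by move=> xU; rewrite setDUl [W :\ x](setDidPl _) // disjoint_sym disjoints1 NW.
rewrite (nmatch_rec (v := v)) ?inE ?vU // (nmatch_rec vU) mulnDl big_distrl /=.
rewrite setDUW // IH //; congr (_ + _).
apply: eq_big => [w|w /andP[/setUP[wU|wW] vw]].
- by rewrite inE; case: (boolP (w \in W)) => //= [wW|_]; rewrite ?orbF //
    (negPf (noUW _ _ vU wW)) !andbF.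
- by rewrite setDUW // IH // subsetDl.
- by rewrite (negPf (noUW _ _ vU wW)) in vw.
Qed.

(* The matchings avoiding the cut vertex [v] are counted twice on the right,
   which the second term on the left makes up for. *)
Lemma nmatch_cut U W v : v \in U -> v \in W -> [disjoint U :\ v & W :\ v] ->
  (forall x y, x \in U :\ v -> y \in W :\ v -> ~~ edge x y) ->
  nmatch (U :|: W) + nmatch (U :\ v) * nmatch (W :\ v)
  = nmatch U * nmatch (W :\ v) + nmatch (U :\ v) * nmatch W.
Proof.
move=> vU vW dUW noUW.
have prod A B : A \subset U :\ v -> B \subset W :\ v ->
    nmatch (A :|: B) = nmatch A * nmatch B.
  move=> /[dup] sA /subsetP sA' /[dup] sB /subsetP sB'; apply: nmatchU.
    exact: disjointW dUW.
  by move=> x y xA yB; rewrite noUW ?sA' ?sB'.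
have nv w : edge v w -> w != v by apply: contraTneq => ->; rewrite edge_irr.
rewrite (nmatch_rec (v := v)) ?inE ?vU // setDUl prod //.
rewrite (nmatch_rec vU) (nmatch_rec vW) mulnDl mulnDr.
(* The terms for matchings avoiding [v] cancel; what remains is a sum over the neighbours of [v] in
   the union, each lying in exactly one of [U] and [W]. *)
suff -> : \sum_(w in U :|: W | edge v w) nmatch ((U :\ v :|: W :\ v) :\ w)
  = (\sum_(w in U | edge v w) nmatch (U :\ v :\ w)) * nmatch (W :\ v)
    + nmatch (U :\ v) * \sum_(w in W | edge v w) nmatch (W :\ v :\ w) by lia.
rewrite (bigID (mem U)) /= big_distrl big_distrr /=.
congr (_ + _); apply: eq_big => [w|w].
- by rewrite !inE; case: (w \in U); rewrite ?andbT ?andbF.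
- case/andP=> /andP[_ vw] wU.
  rewrite setDUl [W :\ v :\ w](setDidPl _) ?prod ?subsetDl //.
  by rewrite disjoint_sym disjoints1 (disjointFr dUW) // !inE nv.
- rewrite inE; case: (boolP (w \in U)) => wU; rewrite ?andbF //= ?andbT //.
  apply/esym/negbTE/negP => /andP[wW vw].
  by have := disjointFr dUW (x := w); rewrite !inE nv // wU wW => /(_ isT).
- case/andP=> /andP[_ vw] wU.
  rewrite setDUl [U :\ v :\ w](setDidPl _) ?prod ?subsetDl //.
  by rewrite disjoint_sym disjoints1 inE (negPf wU) andbF.
Qed.

End Matchings.

(** * Embeddings and isomorphisms *)

Lemma imsetD1 (aT rT : finType) (f : aT -> rT) (A : {set aT}) x :
  injective f -> (f @: A) :\ f x = f @: (A :\ x).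
Proof.
move=> f_inj; apply/setP => y; apply/setD1P/imsetP => [[yx /imsetP[z zB y_z]]|[z]].
  by exists z => //; apply/setD1P; split=> //; apply: contraNneq yx => zx; rewrite y_z zx.
by case/setD1P=> zx zB ->; rewrite (inj_eq f_inj) imset_f.
Qed.

(** An embedding onto an induced subgraph respects the recursion [nmatch_rec]. Surjectivity is not
    assumed, so this serves the three pieces of a glued graph as well as isomorphisms. *)
Lemma nmatch_imset (G H : sgraph) (f : G -> H) (A : {set G}) :
  injective f -> (forall x y, edge (f x) (f y) = edge x y) ->
  nmatch (f @: A) = nmatch A.
Proof.
move=> f_inj fE; elim/setD1_ind: A => [|A v vA IHA].
  by rewrite imset0 !nmatch_set0.
rewrite (nmatch_rec (imset_f f vA)) (nmatch_rec vA).
rewrite imsetD1 // IHA //; congr (_ + _).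
rewrite big_imset_cond /=; last by move=> x y _ _ /f_inj.
apply: eq_big => [w|w _]; first by rewrite fE.
by rewrite imsetD1 // IHA // subsetDl.
Qed.

Lemma hosoya_iso (G H : sgraph) : iso G H -> hosoya G = hosoya H.
Proof.
case=> f [[g fK gK] fE]; rewrite !hosoyaE -(nmatch_imset setT (can_inj fK) fE).
by congr nmatch; apply/setP => x; rewrite inE -[x]gK imset_f ?inE.
Qed.

(** * The Hosoya index of a glued graph *)

Section GlueCount.
Variables (G : pgraph) (S : lrgraph).
Local Notation g := (base G).
Local Notation l := (lbase S).
Local Notation r := (rbase S).

Lemma glue_reprK u : glue_repr (glue_repr u : glue_sum G S) == glue_repr u.
Proof. by case: u => [x|[x|x]] //=; case: ifP => //= ->. Qed.

Definition glue_proj (u : glue_sum G S) : glue G S :=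
  exist (fun u => glue_repr u == u) (glue_repr u) (glue_reprK u).

Definition from_kernel (s : S) : glue G S := glue_proj (inl s).
Definition from_left (x : G) : glue G S := glue_proj (inr (inl x)).
Definition from_right (x : G) : glue G S := glue_proj (inr (inr x)).

Lemma glue_projK (v : glue G S) : glue_proj (val v) = v.
Proof. by apply: val_inj; case: v => u /= /eqP. Qed.

Lemma glue_proj_eq u v : (glue_proj u == glue_proj v) = (glue_repr u == glue_repr v).
Proof. by rewrite -val_eqE. Qed.

Lemma glue_cases (v : glue G S) :
  (exists s, v = from_kernel s) \/
  (exists2 x, x != g & v = from_left x \/ v = from_right x).
Proof.
rewrite -[v]glue_projK; case: v => -[s|[x|x]] /= ux; first by left; exists s.
- by right; exists x; [case: ifP ux | left].
- by right; exists x; [case: ifP ux | right].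
Qed.

Lemma from_left_base : from_left g = from_kernel l.
Proof. by apply/eqP; rewrite glue_proj_eq /= eqxx. Qed.

Lemma from_right_base : from_right g = from_kernel r.
Proof. by apply/eqP; rewrite glue_proj_eq /= eqxx. Qed.

Lemma edge_glueP (u v : glue G S) : reflect
  (exists p q, [/\ glue_proj p = u, glue_proj q = v & sum_edge p q]) (edge u v).
Proof.
apply: (iffP existsP) => [[p /existsP[q /and3P[/eqP pu /eqP qv pq]]]|].
  by exists p, q; split=> //; apply: val_inj.
by case=> p [q [<- <- pq]]; exists p; apply/existsP; exists q; rewrite /= !eqxx.
Qed.

Lemma from_kernel_inj : injective from_kernel.
Proof. by move=> s t /eqP; rewrite glue_proj_eq => /eqP[]. Qed.

Lemma from_left_inj : injective from_left.
Proof.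
move=> x y /eqP; rewrite glue_proj_eq /=.
by case: (x =P g) (y =P g) => [->|_] [->|_] // /eqP[].
Qed.

Lemma from_right_inj : injective from_right.
Proof.
move=> x y /eqP; rewrite glue_proj_eq /=.
by case: (x =P g) (y =P g) => [->|_] [->|_] // /eqP[].
Qed.

(** Meant for the maps that retract the glued graph onto one of its pieces and send the other pieces
    to base points; hence an edge may be contracted. *)
Lemma edge_retract (H : sgraph) (h : glue_sum G S -> H) :
  (forall p, h (glue_repr p) = h p) ->
  (forall p q, sum_edge p q -> edge (h p) (h q) || (h p == h q)) ->
  forall u v : glue G S, edge u v ->
    edge (h (val u)) (h (val v)) || (h (val u) == h (val v)).
Proof.
by move=> hE hP u v /edge_glueP[p [q [<- <- /hP]]]; rewrite /= !hE.
Qed.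

(** An edge between two images under [f] retracts to an edge; it cannot be contracted, because the
    glued graph has no loops. *)
Lemma edge_retract_inj (H : sgraph) (h : glue_sum G S -> H) (f : H -> glue G S) :
  injective f -> (forall x, h (val (f x)) = x) ->
  (forall x y, edge x y -> edge (f x) (f y)) ->
  (forall p, h (glue_repr p) = h p) ->
  (forall p q, sum_edge p q -> edge (h p) (h q) || (h p == h q)) ->
  forall x y, edge (f x) (f y) = edge x y.
Proof.
move=> f_inj fK fE hE hP x y; apply/idP/idP => [|/fE//] fxy.
have := edge_retract hE hP fxy; rewrite !fK => /orP[//|/eqP xy].
by rewrite xy edge_irr in fxy.
Qed.

Definition to_kernel (u : glue_sum G S) : S :=
  match u with inl s => s | inr (inl _) => l | inr (inr _) => r end.
Definition to_left (u : glue_sum G S) : G :=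
  match u with inr (inl x) => x | _ => g end.
Definition to_right (u : glue_sum G S) : G :=
  match u with inr (inr x) => x | _ => g end.

Lemma to_kernel_repr u : to_kernel (glue_repr u) = to_kernel u.
Proof. by case: u => [s|[x|x]] //=; case: ifP. Qed.

Lemma to_kernel_edge p q :
  sum_edge p q -> edge (to_kernel p) (to_kernel q) || (to_kernel p == to_kernel q).
Proof. by case: p q => [s|[x|x]] [t|[y|y]] //= => [->|_|_] //; rewrite eqxx orbT. Qed.

Lemma edge_from_kernel s t : edge (from_kernel s) (from_kernel t) = edge s t.
Proof.
apply: (edge_retract_inj from_kernel_inj _ _ to_kernel_repr to_kernel_edge) => //.
by move=> x y xy; apply/edge_glueP; exists (inl x), (inl y).
Qed.

Lemma edge_from_left x y : edge (from_left x) (from_left y) = edge x y.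
Proof.
apply: (@edge_retract_inj _ to_left) => {x y}.
- exact: from_left_inj.
- by move=> x /=; case: eqP.
- by move=> x y xy; apply/edge_glueP; exists (inr (inl x)), (inr (inl y)).
- by case=> [s|[x|x]] //=; case: eqP.
- by case=> [s|[x|x]] [t|[y|y]] //= => [_|->|_] //; rewrite eqxx orbT.
Qed.

Lemma edge_from_right x y : edge (from_right x) (from_right y) = edge x y.
Proof.
apply: (@edge_retract_inj _ to_right) => {x y}.
- exact: from_right_inj.
- by move=> x /=; case: eqP.
- by move=> x y xy; apply/edge_glueP; exists (inr (inr x)), (inr (inr y)).
- by case=> [s|[x|x]] //=; case: eqP.
- by case=> [s|[x|x]] [t|[y|y]] //= => [_|_|->] //; rewrite eqxx orbT.
Qed.

(** Away from the base point an identification class is a singleton, so every edge at such a vertex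
    comes from the left copy. *)
Lemma edge_from_leftP x v : x != g -> edge (from_left x) v -> exists y, v = from_left y.
Proof.
move=> xg /edge_glueP[p [q [/eqP + <-]]]; rewrite glue_proj_eq /= (negPf xg).
case: p q => [s|[z|z]] [t|[y|y]] //=; do ?[by case: ifP].
by exists y.
Qed.

Lemma edge_from_rightP x v :
  x != g -> edge (from_right x) v -> exists y, v = from_right y.
Proof.
move=> xg /edge_glueP[p [q [/eqP + <-]]]; rewrite glue_proj_eq /= (negPf xg).
case: p q => [s|[z|z]] [t|[y|y]] //=; do ?[by case: ifP].
by exists y.
Qed.

Lemma from_left_eq_kernel x s : from_left x = from_kernel s -> x = g /\ s = l.
Proof. by move/eqP; rewrite glue_proj_eq /=; case: (x =P g) => // -> /eqP[->]. Qed.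

Lemma from_right_eq_kernel x s : from_right x = from_kernel s -> x = g /\ s = r.
Proof. by move/eqP; rewrite glue_proj_eq /=; case: (x =P g) => // -> /eqP[->]. Qed.

Lemma from_left_eq_right x y : from_left x = from_right y -> x = g /\ y = g.
Proof.
by move/eqP; rewrite glue_proj_eq /=; case: (x =P g) (y =P g) => [->|_] [->|_].
Qed.

(** The retraction [to_kernel] maps a path of the glued graph to a walk in [S], once the contracted
    steps are dropped. *)
Lemma connected_kernel : connected (glue G S) -> connected S.
Proof.
move=> conn s t; have /connectP[p] := conn (from_kernel s) (from_kernel t).
(* The ends are written as retracts so that the induction runs over arbitrary vertices of the glued
   graph. *)
rewrite -[s]/(to_kernel (val (from_kernel s))).
rewrite -[t in connect _ _ t]/(to_kernel (val (from_kernel t))).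
move: (from_kernel s) (from_kernel t) => u v.
elim: p u => [|w p IHp] u /=; first by move=> _ ->.
case/andP=> uw pw vE; apply: connect_trans (IHp w pw vE).
have /orP[/connect1//|/eqP->] := edge_retract to_kernel_repr to_kernel_edge uw.
exact: connect0.
Qed.

Local Notation kernel_set B := [set from_kernel s | s in (B : {set S})].
Local Notation left_set B := [set from_left x | x in (B : {set G})].
Local Notation right_set B := [set from_right x | x in (B : {set G})].

Lemma nmatch_from_kernel (A : {set S}) : nmatch (kernel_set A) = nmatch A.
Proof. exact: nmatch_imset from_kernel_inj edge_from_kernel. Qed.

Lemma nmatch_from_left (A : {set G}) : nmatch (left_set A) = nmatch A.
Proof. exact: nmatch_imset from_left_inj edge_from_left. Qed.

Lemma nmatch_from_right (A : {set G}) : nmatch (right_set A) = nmatch A.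
Proof. exact: nmatch_imset from_right_inj edge_from_right. Qed.

Lemma kernel_right_apart (B : {set S}) :
  r \notin B ->
  [disjoint kernel_set B & right_set (setT :\ g)] /\
  (forall u v, u \in kernel_set B -> v \in right_set (setT :\ g) -> ~~ edge u v).
Proof.
move=> rB; split.
  apply/pred0P => u /=; apply/negbTE/negP => /andP[/imsetP[s _ ->]].
  by case/imsetP=> y /setD1P[yg _] /esym/from_right_eq_kernel[/eqP]; rewrite (negPf yg).
move=> _ _ /imsetP[s sB ->] /imsetP[y /setD1P[yg _] ->]; rewrite edge_sym.
apply/negP => /(edge_from_rightP yg)[z] /esym/from_right_eq_kernel[_ sr].
by rewrite -sr sB in rB.
Qed.

Lemma nmatch_kernel_rightD1 (B : {set S}) : r \notin B ->
  nmatch (kernel_set B :|: right_set (setT :\ g)) = nmatch B * nmatch ([set: G] :\ g).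
Proof.
move=> /kernel_right_apart[dis noE].
by rewrite nmatchU // nmatch_from_kernel nmatch_from_right.
Qed.

Lemma nmatch_kernel_right (B : {set S}) : r \in B ->
  nmatch (kernel_set B :|: right_set setT) + nmatch (B :\ r) * nmatch ([set: G] :\ g)
  = nmatch B * nmatch ([set: G] :\ g) + nmatch (B :\ r) * nmatch [set: G].
Proof.
move=> rB; have := @nmatch_cut _ (kernel_set B) (right_set setT) (from_kernel r).
have [|dis noE] := @kernel_right_apart (B :\ r); first by rewrite !inE eqxx.
rewrite (imsetD1 _ _ from_kernel_inj) -from_right_base (imsetD1 _ _ from_right_inj).
rewrite !nmatch_from_kernel !nmatch_from_right.
by apply => //; [rewrite from_right_base imset_f | rewrite imset_f].
Qed.

(** If [l = r], deleting it detaches the right copy; otherwise that copy still hangs at [r], and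
    [nmatch_kernel_right] applies to [S] without [l]. The factor [l != r] joins the two cases. *)
Lemma nmatch_kernel_right_lbase :
  nmatch ((kernel_set setT :|: right_set setT) :\ from_kernel l)
    + (l != r) * (nmatch ([set: S] :\ l :\ r) * nmatch ([set: G] :\ g))
  = nmatch ([set: S] :\ l) * nmatch ([set: G] :\ g)
    + (l != r) * (nmatch ([set: S] :\ l :\ r) * nmatch [set: G]).
Proof.
rewrite setDUl (imsetD1 _ _ from_kernel_inj).
case: eqVneq => [lr|lr] /=.
  rewrite lr -from_right_base (imsetD1 _ _ from_right_inj).
  by rewrite !mul0n !addn0 nmatch_kernel_rightD1 // !inE eqxx.
rewrite [X in _ :|: X](setDidPl _) ?mul1n; last first.
  rewrite disjoint_sym disjoints1; apply/imsetP => -[y _].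
  by move/esym/from_right_eq_kernel => [_ /eqP]; rewrite (negPf lr).
by rewrite nmatch_kernel_right // !inE eq_sym lr.
Qed.

(** The glued graph is cut at [l] to split off the left copy, and what remains is cut at [r] to
    split off the right one. *)
Lemma hosoya_glue (x := nmatch ([set: G] :\ g)) (y := nmatch [set: G] - x) :
  hosoya (glue G S) = x ^ 2 * hosoya S
    + x * y * (nmatch ([set: S] :\ l) + nmatch ([set: S] :\ r))
    + y ^ 2 * ((l != r) * nmatch ([set: S] :\ l :\ r)).
Proof.
rewrite {}/y {}/x.
have cov : [set: glue G S] = left_set setT :|: (kernel_set setT :|: right_set setT).
  apply/setP => v; rewrite !inE.
  by have [[s ->]|[x _ [] ->]] := glue_cases v; rewrite imset_f ?orbT ?inE.
(* A vertex of the left copy that lies in the rest must be the base point, which the deletion of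
   [from_kernel l] removes. *)
have KR z : from_left z \notin (kernel_set setT :|: right_set setT) :\ from_kernel l.
  apply/negP => /setD1P[zl /setUP[] /imsetP[t _]].
    by move/from_left_eq_kernel => [zg _]; rewrite zg from_left_base eqxx in zl.
  by move/from_left_eq_right => [zg _]; rewrite zg from_left_base eqxx in zl.
have := @nmatch_cut _ (left_set setT) (kernel_set setT :|: right_set setT) (from_kernel l).
have -> : from_kernel l \in left_set setT by rewrite -from_left_base imset_f.
have -> : from_kernel l \in kernel_set setT :|: right_set setT by rewrite inE imset_f.
move=> /(_ isT isT) cut; move: cut.
have dis : [disjoint left_set setT :\ from_kernel l
    & (kernel_set setT :|: right_set setT) :\ from_kernel l].
  apply/pred0P => u /=; apply/negbTE/negP => /andP[/setD1P[_ /imsetP[z _ ->]]].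
  by apply/negP.
move=> /(_ dis) cut; move: cut.
have noE u v : u \in left_set setT :\ from_kernel l ->
    v \in (kernel_set setT :|: right_set setT) :\ from_kernel l -> ~~ edge u v.
  move=> /setD1P[+ /imsetP[z _ u_z]]; rewrite {u}u_z -from_left_base.
  rewrite (inj_eq from_left_inj) => zg vKR; apply/negP => /(edge_from_leftP zg)[w v_w].
  by rewrite from_left_base v_w (negPf (KR w)) in vKR.
move=> /(_ noE).
have -> : left_set setT :\ from_kernel l = left_set (setT :\ g).
  by rewrite -from_left_base (imsetD1 _ _ from_left_inj).
rewrite -cov -hosoyaE !nmatch_from_left.
have := nmatch_kernel_right_lbase.
have := nmatch_kernel_right (in_setT r).
(* This makes the truncated subtraction in [y] exact. *)
have := nmatch_sub (subsetDl [set: G] [set g]).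
rewrite -[nmatch [set: S]]hosoyaE => /subnK <-; rewrite addnK.
move: (nmatch (_ :|: _)) (nmatch ((_ :|: _) :\ _)) => u w Eu Ew.
have {Eu} -> : u = hosoya S * nmatch ([set: G] :\ g)
    + nmatch ([set: S] :\ r) * (nmatch [set: G] - nmatch ([set: G] :\ g)) by lia.
have {Ew} -> : w = nmatch ([set: S] :\ l) * nmatch ([set: G] :\ g)
    + (l != r) * (nmatch ([set: S] :\ l :\ r) * (nmatch [set: G] - nmatch ([set: G] :\ g))).
  by lia.
by rewrite -!mulnn; lia.
Qed.

End GlueCount.

(** * The coefficients of the kernel *)

(** The bounds on the coefficients reflect that a vertex-deleted subgraph has at least one matching
    and at most as many as the whole graph. They leave finitely many pairs [(x, y)] for each of the
    three values used. *)
Lemma kernel_coefficients (a0 a1 a2 b0 b1 b2 c0 c1 c2 : nat) :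
  0 < a0 -> 0 < b0 -> 2 <= a1 -> 2 <= b1 -> a1 <= a0.*2 -> a2 <= a0 ->
  (forall m n, P1 m n -> exists x y, [/\ 0 < x,
     m ^ 2 - n ^ 2 = x ^ 2 * a0 + x * y * a1 + y ^ 2 * a2,
     2 * m * n = x ^ 2 * b0 + x * y * b1 + y ^ 2 * b2 &
     m ^ 2 + n ^ 2 = x ^ 2 * c0 + x * y * c1 + y ^ 2 * c2]) ->
  [/\ [/\ a0 = 3, a1 = 4 & a2 = 1], [/\ b0 = 4, b1 = 2 & b2 = 0]
    & [/\ c0 = 5, c1 = 4 & c2 = 1]].
Proof.
move=> a0_gt0 b0_gt0 a1_ge2 b1_ge2 a1_le a2_le fam.
have [|x1 [y1 [x1_gt0 A1 B1 C1]]] := fam 2 1; first by [].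
have [|x2 [y2 [x2_gt0 A2 B2 C2]]] := fam 4 1; first by [].
have [|x3 [y3 [x3_gt0 A3 B3 C3]]] := fam 5 2; first by [].
have x1E : x1 = 1 by nia.
have y1_le : y1 <= 1 by nia.
have x2_le : x2 <= 3 by nia.
have y2_le : y2 <= 7 by nia.
subst x1.
(* With [y1 = 1] the first form would be x^2 + 2xy, and x(x + 2y) = 15 leaves only (1, 7) and (3,
   1), where the second form exceeds 8. *)
have y1E : y1 = 0.
  case: y1 y1_le A1 B1 C1 => [|[|]] // _ A1 B1 C1.
  have [??] : a0 = 1 /\ a1 = 2 by lia.
  have ? : a2 = 0 by lia.
  subst; exfalso; clear C1 C2 A3 B3 C3.
  case: x2 x2_gt0 x2_le A2 B2 => [|[|[|[|]]]] // _ _;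
  case: y2 y2_le => [|[|[|[|[|[|[|[|]]]]]]]] // _; lia.
subst y1.
have {A1 B1 C1} [? ? ?] : [/\ a0 = 3, b0 = 4 & c0 = 5] by split; lia.
subst.
have ? : x2 = 1 by nia.
subst x2.
(* [y2 = 1] would need [a1 + a2 = 12], above the bound 6 + 3, and [y2 > 2] is excluded by
   [b1 >= 2]. *)
have ? : y2 = 2.
  by move: y2_le A2 B2 C2; case: y2 => [|[|[|[|[|[|[|[|]]]]]]]] // *; lia.
subst y2.
have [? ?] : b1 = 2 /\ b2 = 0 by lia.
subst.
have x3_le : x3 <= 2 by nia.
have y3_le : y3 <= 10 by nia.
(* The second form now says x(2x + y) = 10, so the pair is (1, 8) or (2, 1). The first is
   impossible, since 21 - 3 = 18 is not a multiple of 8. *)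
case: x3 x3_gt0 x3_le A3 B3 C3 => [|[|[|]]] // _ _ A3 B3 C3;
  [have ? : y3 = 8 by lia | have ? : y3 = 1 by lia];
subst y3; split; split; lia.
Qed.

(** * Recognising the three caterpillars *)

(** Matching two enumerations position by position reduces an isomorphism to a finite table of
    edges; the values of [f] are kept in order to follow base points. [x0] and [y0] are default
    values of [nth]. *)
Lemma iso_seq (G H : sgraph) (x0 : G) (y0 : H) (s : seq G) (t : seq H) :
  uniq s -> uniq t -> (forall x, x \in s) -> (forall y, y \in t) ->
  size s = size t ->
  (forall i j, i < size s -> j < size s ->
    edge (nth x0 s i) (nth x0 s j) = edge (nth y0 t i) (nth y0 t j)) ->
  exists2 f : G -> H, is_iso f & forall i, i < size s -> f (nth x0 s i) = nth y0 t i.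
Proof.
move=> Us Ut s_all t_all sz_st eE; exists (fun x => nth y0 t (index x s)).
  split=> [|x y]; last by rewrite -eE ?index_mem // !nth_index.
  exists (fun y => nth x0 s (index y t)) => x.
    by rewrite index_uniq ?nth_index // -sz_st index_mem.
  by rewrite index_uniq ?nth_index // sz_st index_mem.
by move=> i i_s; rewrite index_uniq.
Qed.

Definition cat_vx a i k (i_a : i < size a) (k_ai : k < nth 0 a i) : cat_graph a :=
  @existT 'I_(size a) (fun i => 'I_(nth 0 a i)) (Ordinal i_a) (Ordinal k_ai).

(** Numerical codes can be compared by computation, which settles uniqueness and membership in
    explicit lists of vertices. *)
Definition cat_code a (u : cat_vertex a) : nat * nat := (val (tag u), val (tagged u)).

Lemma cat_code_inj a : injective (@cat_code a).
Proof.
case=> i j [i' j'] [/val_inj eq_i]; case: i' / eq_i j' => j' /= /val_inj eq_j.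
by rewrite eq_j.
Qed.

(** This caterpillar is the path on three vertices with its ends as base points. *)
Lemma caterpillar111 (S : lrgraph) (a : S) :
  uniq [:: lbase S; a; rbase S] -> (forall x, x \in [:: lbase S; a; rbase S]) ->
  edge (lbase S) a -> edge a (rbase S) -> ~~ edge (lbase S) (rbase S) ->
  lr_iso S (@caterpillar [:: 1; 1; 1] isT (@Ordinal 3 0 isT) (@Ordinal 3 2 isT)).
Proof.
move=> Us s_all la ar lr.
pose v i k := @cat_vx [:: 1; 1; 1] i k.
pose t := [:: v 0 0 isT isT; v 1 0 isT isT; v 2 0 isT isT].
have [|||||f f_iso fE] := @iso_seq S _ (lbase S) (v 0 0 isT isT) _ t Us.
- exact: (map_uniq (f := @cat_code _)).
- exact: s_all.
- move=> y; rewrite -(mem_map (@cat_code_inj _)).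
  by case: y => -[[|[|[|]]] // ?] [[|] // ?].
- by [].
- case=> [|[|[|]]] // [|[|[|]]] // _ _ /=;
  by rewrite ?(edge_sym a (lbase S)) ?(edge_sym (rbase S)) ?edge_irr ?la ?ar ?(negPf lr).
exists f; split=> //.
  by rewrite (fE 0) //; apply: cat_code_inj.
by rewrite (fE 2) //; apply: cat_code_inj.
Qed.

(** This caterpillar is the path [a], [lbase S], [rbase S], [b]. *)
Lemma caterpillar22 (S : lrgraph) (a b : S) :
  uniq [:: lbase S; rbase S; a; b] -> (forall x, x \in [:: lbase S; rbase S; a; b]) ->
  edge (lbase S) a -> ~~ edge (lbase S) b -> ~~ edge (rbase S) a ->
  edge (rbase S) b -> edge (lbase S) (rbase S) -> ~~ edge a b ->
  lr_iso S (@caterpillar [:: 2; 2] isT (@Ordinal 2 0 isT) (@Ordinal 2 1 isT)).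
Proof.
move=> Us s_all la lb ra rb lr ab.
pose v i k := @cat_vx [:: 2; 2] i k.
(* Spine vertices come first, then the leaves, in the order of the list enumerating [S]. *)
pose t := [:: v 0 0 isT isT; v 1 0 isT isT; v 0 1 isT isT; v 1 1 isT isT].
have [|||||f f_iso fE] := @iso_seq S _ (lbase S) (v 0 0 isT isT) _ t Us.
- exact: (map_uniq (f := @cat_code _)).
- exact: s_all.
- move=> y; rewrite -(mem_map (@cat_code_inj _)).
  by case: y => -[[|[|]] // ?] [[|[|]] // ?].
- by [].
- case=> [|[|[|[|]]]] // [|[|[|[|]]]] // _ _ /=;
  by rewrite ?(edge_sym a) ?(edge_sym b (lbase S)) ?(edge_sym b (rbase S))
    ?(edge_sym b a) ?(edge_sym (rbase S) (lbase S)) ?edge_irr ?la ?rb ?lr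
    ?(negPf lb) ?(negPf ra) ?(negPf ab).
exists f; split=> //.
  by rewrite (fE 0) //; apply: cat_code_inj.
by rewrite (fE 1) //; apply: cat_code_inj.
Qed.

(** This caterpillar is the star with three leaves and both base points at its centre. *)
Lemma caterpillar4 (S : lrgraph) (a b c : S) : lbase S = rbase S ->
  uniq [:: lbase S; a; b; c] -> (forall x, x \in [:: lbase S; a; b; c]) ->
  edge (lbase S) a -> edge (lbase S) b -> edge (lbase S) c ->
  ~~ edge a b -> ~~ edge a c -> ~~ edge b c ->
  lr_iso S (@caterpillar [:: 4] isT (@Ordinal 1 0 isT) (@Ordinal 1 0 isT)).
Proof.
move=> eq_lr Us s_all la lb lc ab ac bc.
pose v k := @cat_vx [:: 4] 0 k isT.
pose t := [:: v 0 isT; v 1 isT; v 2 isT; v 3 isT].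
have [|||||f f_iso fE] := @iso_seq S _ (lbase S) (v 0 isT) _ t Us.
- exact: (map_uniq (f := @cat_code _)).
- exact: s_all.
- move=> y; rewrite -(mem_map (@cat_code_inj _)).
  by case: y => -[[|] // ?] [[|[|[|[|]]]] // ?].
- by [].
- case=> [|[|[|[|]]]] // [|[|[|[|]]]] // _ _ /=;
  by rewrite ?(edge_sym _ (lbase S)) ?(edge_sym b a) ?(edge_sym c) ?edge_irr
    ?la ?lb ?lc ?(negPf ab) ?(negPf ac) ?(negPf bc).
have f0 : f (lbase S) = v 0 isT by rewrite (fE 0).
by exists f; split; rewrite // -?eq_lr f0; apply: cat_code_inj.
Qed.

(** * Kernels with prescribed coefficients *)

Section Structure.
Variable G : sgraph.
Implicit Types (A B : {set G}) (v w : G).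

Lemma nmatch1_sub A B : nmatch B = 1 -> A \subset B -> nmatch A = 1.
Proof. by move=> B1 /nmatch_sub; rewrite B1; have := nmatch_gt0 A; lia. Qed.

(** An edge inside [A] would be a second matching besides the empty one. *)
Lemma nmatch1_noedge A v w :
  nmatch A = 1 -> v \in A -> w \in A -> ~~ edge v w.
Proof.
move=> A1 vA wA; apply/negP => vw; move: A1.
rewrite (nmatch_rec vA) (bigD1 w) ?wA //=.
by have := nmatch_gt0 (A :\ v); have := nmatch_gt0 (A :\ v :\ w); lia.
Qed.

(** No edge inside [A] avoids [v], so a nonempty matching there is a single edge at [v]. *)
Lemma nmatch_star A v : v \in A -> nmatch (A :\ v) = 1 ->
  nmatch A = 1 + #|[set w in A | edge v w]|.
Proof.
move=> vA A1; rewrite (nmatch_rec vA) A1 -sum1_card; congr (_ + _).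
apply: eq_big => [w|w _]; first by rewrite inE.
exact: nmatch1_sub A1 (subsetDl _ _).
Qed.

Lemma connected_edge v w : connected G -> v != w -> exists u, edge v u.
Proof.
move=> conn vw; have /connectP[[|u p] /=] := conn v w.
  by move=> _ wv; rewrite wv eqxx in vw.
by case/andP=> vu _ _; exists u.
Qed.

Variables l r : G.
Hypothesis lr_neq : l != r.
Hypothesis lr1 : nmatch ([set: G] :\ l :\ r) = 1.
(** By [lr1] every edge meets [l] or [r]. These two vertices are the hubs, and [P] and [Q] hold the
    far ends of their spokes, the edge between the hubs excepted. *)
Let P := [set w | edge l w && (w != r)].
Let Q := [set w | edge r w && (w != l)].

Lemma nmatch_hubD1l : nmatch ([set: G] :\ l) = 1 + #|Q|.
Proof.
rewrite (nmatch_star (v := r)) ?inE 1?eq_sym ?lr_neq //; congr (1 + _).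
by apply: eq_card => w; rewrite !inE andbT andbC.
Qed.

Lemma nmatch_hubD1r : nmatch ([set: G] :\ r) = 1 + #|P|.
Proof.
have lr1' : nmatch ([set: G] :\ r :\ l) = 1.
  by rewrite -lr1; congr nmatch; apply/setP => w; rewrite !inE andbCA.
rewrite (nmatch_star (v := l)) ?inE ?lr_neq //; congr (1 + _).
by apply: eq_card => w; rewrite !inE andbT andbC.
Qed.

(** Matchings are sorted by the partner of [l]: none, [r], or some [w] in [P]. In the last case [r]
    is free or matched into [Q :\ w]. *)
Lemma hosoya_hubs :
  hosoya G = 1 + #|Q| + edge l r + \sum_(w in P) (1 + #|Q :\ w|).
Proof.
rewrite hosoyaE (nmatch_rec (in_setT l)) nmatch_hubD1l -[RHS]addnA; congr (1 + #|Q| + _).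
have -> : \sum_(w in [set: G] | edge l w) nmatch ([set: G] :\ l :\ w)
    = \sum_(w | edge l w) nmatch ([set: G] :\ l :\ w).
  by apply: eq_bigl => w; rewrite inE.
rewrite (bigID (eq_op^~ r)) /=; congr (_ + _).
  have [lr|/negPf nlr] := boolP (edge l r).
    rewrite (eq_bigl (pred1 r)) ?big_pred1_eq ?lr1 // => w /=.
    by case: eqP => [->|_]; rewrite ?lr ?andbF.
  by apply: big_pred0 => w; case: eqP => [->|_]; rewrite ?nlr ?andbF.
apply: eq_big => [w|w /andP[lw wr]]; first by rewrite inE.
rewrite (nmatch_star (v := r)).
- by congr (1 + _); apply: eq_card => u; rewrite !inE andbT -andbA [_ && edge r u]andbC.
- by rewrite !inE eq_sym wr eq_sym lr_neq.
- by apply: nmatch1_sub lr1 _; apply/subsetP => u; rewrite !inE => /and3P[-> _ ->].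
Qed.

(** Connectivity gives [v] a neighbour, which by [lr1] is [l] or [r]. *)
Lemma hub_or_spoke v : connected G -> v != l -> v != r -> (v \in P) || (v \in Q).
Proof.
move=> conn vl vr; have [u vu] := connected_edge conn vl.
have [ul|ul] := eqVneq u l; first by rewrite !inE -ul edge_sym vu vr.
have [ur|ur] := eqVneq u r; first by rewrite !inE -ur [edge u v]edge_sym vu vl orbT.
by have := nmatch1_noedge lr1 (v := v) (w := u); rewrite !inE vl vr ul ur vu => /(_ isT isT).
Qed.

End Structure.

(** Used to exclude the uneven split 4 = 1 + 3. Without spokes at [r], connectivity forces the edge
    between the hubs, and with the two spokes at [l] the graph is a star with three edges. *)
Lemma hub_without_spokes (G : sgraph) (l r : G) : connected G -> l != r ->
  nmatch ([set: G] :\ l :\ r) = 1 -> nmatch ([set: G] :\ l) = 1 ->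
  nmatch ([set: G] :\ r) = 3 -> hosoya G = 4.
Proof.
move=> conn lr lr1 l1 r3; have := l1; rewrite (nmatch_hubD1l lr lr1) => -[/eqP].
rewrite cards_eq0 => /eqP Q0.
have [u ru] : exists u, edge r u by apply: (connected_edge (w := l)); rewrite // eq_sym.
have ul : u = l.
  by apply/eqP/negP => /negP ul; have := in_set0 u; rewrite -Q0 inE ru ul.
have rl : edge l r by rewrite edge_sym -ul.
rewrite (hosoya_hubs lr lr1) rl Q0 cards0.
under eq_bigr do rewrite set0D cards0.
by rewrite sum_nat_const muln1; move: r3; rewrite (nmatch_hubD1r lr lr1); lia.
Qed.

(** Both summands are positive and the splits 1 + 3 and 3 + 1 would give index 4, so each hub has
    exactly one spoke. *)
Lemma two_spokes (G : sgraph) (l r : G) : connected G -> l != r ->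
  nmatch ([set: G] :\ l :\ r) = 1 ->
  nmatch ([set: G] :\ l) + nmatch ([set: G] :\ r) = 4 -> hosoya G != 4 ->
  exists a b, [/\ [set w | edge l w && (w != r)] = [set a],
    [set w | edge r w && (w != l)] = [set b] & hosoya G = 3 + edge l r + (a != b)].
Proof.
move=> conn lr lr1 sum4 Z4.
have rl1 : nmatch ([set: G] :\ r :\ l) = 1.
  by rewrite -lr1; congr nmatch; apply/setP => w; rewrite !inE andbCA.
have l1 : nmatch ([set: G] :\ l) != 1.
  apply: contra Z4 => /eqP l1; apply/eqP; apply: (hub_without_spokes conn lr) => //.
  by lia.
have r1 : nmatch ([set: G] :\ r) != 1.
  apply: contra Z4 => /eqP r1; apply/eqP.
  by apply: (@hub_without_spokes G r l); rewrite // 1?eq_sym //; lia.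
have l0 := nmatch_gt0 ([set: G] :\ l); have r0 := nmatch_gt0 ([set: G] :\ r).
have [l2 r2] : nmatch ([set: G] :\ l) = 2 /\ nmatch ([set: G] :\ r) = 2 by lia.
move: l2 r2; rewrite (nmatch_hubD1l lr lr1) (nmatch_hubD1r lr lr1).
move=> -[/eqP/cards1P[b Q1]] [/eqP/cards1P[a P1]].
exists a, b; split=> //.
rewrite (hosoya_hubs lr lr1) P1 Q1 cards1 big_set1.
have -> : #|[set b] :\ a| = (a != b).
  have [->|ab] := eqVneq a b; first by rewrite setDv cards0.
  by rewrite (setDidPl _) ?cards1 // disjoints1 inE eq_sym ab.
by lia.
Qed.

(** Index 3 makes both correction terms of [two_spokes] vanish: the spokes share their far end and
    the hubs are not adjacent. *)
Lemma path3_of_hosoya (S : lrgraph) : connected S -> lbase S != rbase S ->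
  nmatch ([set: S] :\ lbase S :\ rbase S) = 1 ->
  nmatch ([set: S] :\ lbase S) + nmatch ([set: S] :\ rbase S) = 4 -> hosoya S = 3 ->
  lr_iso S (@caterpillar [:: 1; 1; 1] isT (@Ordinal 3 0 isT) (@Ordinal 3 2 isT)).
Proof.
move=> conn lr lr1 sum4 Z3.
have [|a [b [Pa Qb]]] := two_spokes conn lr lr1 sum4; first by rewrite Z3.
rewrite Z3; case: eqVneq => [<-{b}|_] in Qb *; last by lia.
move=> E; have nlr : ~~ edge (lbase S) (rbase S) by lia.
have /andP[la ar] : edge (lbase S) a && (a != rbase S).
  by have := set11 a; rewrite -Pa inE.
have /andP[ra al] : edge (rbase S) a && (a != lbase S).
  by have := set11 a; rewrite -Qb inE.
apply: (@caterpillar111 _ a) => //; last by rewrite edge_sym.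
  by rewrite /= !inE negb_or eq_sym al lr ar.
move=> v; rewrite !inE; have [//|vl] := eqVneq v (lbase S).
have [|vr] := eqVneq v (rbase S); first by rewrite !orbT.
by have := hub_or_spoke lr1 conn vl vr; rewrite Pa Qb inE orbb => ->.
Qed.

(** Index 5 requires both correction terms of [two_spokes] to be 1: the hubs are adjacent and the
    spokes have different far ends. *)
Lemma path4_of_hosoya (S : lrgraph) : connected S -> lbase S != rbase S ->
  nmatch ([set: S] :\ lbase S :\ rbase S) = 1 ->
  nmatch ([set: S] :\ lbase S) + nmatch ([set: S] :\ rbase S) = 4 -> hosoya S = 5 ->
  lr_iso S (@caterpillar [:: 2; 2] isT (@Ordinal 2 0 isT) (@Ordinal 2 1 isT)).
Proof.
move=> conn lr lr1 sum4 Z5.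
have [|a [b [Pa Qb]]] := two_spokes conn lr lr1 sum4; first by rewrite Z5.
rewrite Z5 => E; have [elr ab] : edge (lbase S) (rbase S) /\ a != b by split; lia.
have /andP[la ar] : edge (lbase S) a && (a != rbase S).
  by have := set11 a; rewrite -Pa inE.
have /andP[rb bl] : edge (rbase S) b && (b != lbase S).
  by have := set11 b; rewrite -Qb inE.
have al : a != lbase S by apply: contraTneq la => ->; rewrite edge_irr.
have br : b != rbase S by apply: contraTneq rb => ->; rewrite edge_irr.
apply: (@caterpillar22 _ a b) => //.
- by rewrite /= !inE !negb_or lr ab ![_ == a]eq_sym ![_ == b]eq_sym al ar bl br.
- move=> v; rewrite !inE; have [//|vl] := eqVneq v (lbase S).
  have [|vr] := eqVneq v (rbase S); first by rewrite !orbT.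
  by have := hub_or_spoke lr1 conn vl vr; rewrite Pa Qb !inE.
- by have := in_set1 b a; rewrite -Pa inE br andbT eq_sym (negPf ab) => ->.
- by have := in_set1 a b; rewrite -Qb inE al andbT (negPf ab) => ->.
- by apply: nmatch1_noedge lr1 _ _; rewrite !inE ?al ?ar ?bl ?br.
Qed.

(** All edges contain the common base point, so its degree is the index minus one, and connectivity
    leaves no vertex besides its neighbours. *)
Lemma star4_of_hosoya (S : lrgraph) : connected S -> lbase S = rbase S ->
  nmatch ([set: S] :\ lbase S) = 1 -> hosoya S = 4 ->
  lr_iso S (@caterpillar [:: 4] isT (@Ordinal 1 0 isT) (@Ordinal 1 0 isT)).
Proof.
move=> conn lr l1; rewrite hosoyaE (nmatch_star (in_setT _) l1) => -[].
set N := [set w in _ | _]; have NE w : (w \in N) = edge (lbase S) w by rewrite !inE.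
have := enum_uniq N; have := mem_enum N; rewrite cardE.
case: (enum N) => [|a [|b [|c [|]]]] //= eN U _.
have edgeN v : (edge (lbase S) v) = (v \in [:: a; b; c]) by rewrite -NE -eN.
have neqN v : v \in [:: a; b; c] -> v != lbase S.
  by rewrite -edgeN; apply: contraTneq => ->; rewrite edge_irr.
have noE u v : u != lbase S -> v != lbase S -> ~~ edge u v.
  by move=> ul vl; apply: nmatch1_noedge l1 _ _; rewrite !inE ?ul ?vl.
have [al bl cl] : [/\ a != lbase S, b != lbase S & c != lbase S].
  by split; apply: neqN; rewrite !inE eqxx ?orbT.
apply: (@caterpillar4 _ a b c) => //; rewrite ?edgeN ?noE ?inE ?eqxx ?orbT //.
  rewrite cons_uniq; apply/andP; split; last exact: U.
  by rewrite !inE !negb_or ![lbase S == _]eq_sym al bl cl.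
move=> v; rewrite inE; case: eqVneq => //= vl; rewrite -edgeN.
have [u vu] := connected_edge conn vl.
have [<-|ul] := eqVneq u (lbase S); first by rewrite edge_sym.
by have := noE _ _ vl ul; rewrite vu.
Qed.

(** * From the family to its kernels *)

Lemma connected_iso (G H : sgraph) : iso G H -> connected G -> connected H.
Proof.
case=> f [[f' fK f'K] fE] conn x y; have /connectP[p] := conn (f' x) (f' y).
elim: p x => [|z p IHp] x /=; first by move=> _ /(can_inj f'K) ->.
case/andP=> xz pz yE; apply: connect_trans (IHp (f z) _ _); rewrite ?fK //.
by apply: connect1; rewrite -[x]f'K fE.
Qed.

Theorem theorem3p3 (A B C : nat -> nat -> sgraph) (A1 B1 C1 : lrgraph)
  (conn : forall m n : nat, P1 m n ->
    [/\ connected (A m n), connected (B m n) & connected (C m n)])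
  (hosoya_ABC : forall m n : nat, P1 m n ->
    [/\ hosoya (A m n) = m ^ 2 - n ^ 2,
        hosoya (B m n) = 2 * m * n
      & hosoya (C m n) = m ^ 2 + n ^ 2])
  (kernel : common_symmetric_kernel A B C A1 B1 C1) :
  [/\ lr_iso A1 (@caterpillar [:: 1; 1; 1] isT (@Ordinal 3 0 isT) (@Ordinal 3 2 isT)),
      lr_iso B1 (@caterpillar [:: 4] isT (@Ordinal 1 0 isT) (@Ordinal 1 0 isT))
    & lr_iso C1 (@caterpillar [:: 2; 2] isT (@Ordinal 2 0 isT) (@Ordinal 2 1 isT))].
Proof.
(* A single member of the family already passes its connectivity on to the kernels. *)
have [cA cB cC] : [/\ connected A1, connected B1 & connected C1].
  have P21 : P1 2 1 by [].
  have [G [isoA isoB isoC]] := kernel 2 1 P21; have [cA cB cC] := conn 2 1 P21.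
  by split; apply: (@connected_kernel G); apply: connected_iso; eassumption.
(* [c1] and [c2] are the coefficients of xy and y^2 in [hosoya_glue]; that of x^2 is [hosoya S]. *)
pose c1 (S : lrgraph) := nmatch ([set: S] :\ lbase S) + nmatch ([set: S] :\ rbase S).
pose c2 (S : lrgraph) :=
  (lbase S != rbase S) * nmatch ([set: S] :\ lbase S :\ rbase S).
have c0_gt0 (S : lrgraph) : 0 < hosoya S by rewrite hosoyaE nmatch_gt0.
have le_Z (S : lrgraph) (X : {set S}) : nmatch X <= hosoya S.
  by rewrite hosoyaE nmatch_sub ?subsetT.
have c1_ge2 S : 2 <= c1 S by rewrite (leq_add (nmatch_gt0 _) (nmatch_gt0 _)).
have c1_le S : c1 S <= (hosoya S).*2 by rewrite -addnn leq_add.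
have c2_le S : c2 S <= hosoya S.
  by rewrite /c2; case: eqP => //= _; rewrite mul1n.
have [] := @kernel_coefficients (hosoya A1) (c1 A1) (c2 A1)
  (hosoya B1) (c1 B1) (c2 B1) (hosoya C1) (c1 C1) (c2 C1); rewrite ?c0_gt0 //.
  move=> m n Pmn; have [G [isoA isoB isoC]] := kernel m n Pmn.
  have [<- <- <-] := hosoya_ABC m n Pmn.
  rewrite (hosoya_iso isoA) (hosoya_iso isoB) (hosoya_iso isoC).
  exists (nmatch ([set: G] :\ base G)).
  exists (nmatch [set: G] - nmatch ([set: G] :\ base G)).
  by split; [exact: nmatch_gt0 | exact: hosoya_glue..].
have c2_eq1 S : c2 S = 1 ->
    lbase S != rbase S /\ nmatch ([set: S] :\ lbase S :\ rbase S) = 1.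
  by rewrite /c2; case: eqP => //= _; rewrite mul1n.
case=> ZA A_1 /c2_eq1[lrA A_2] [ZB B_1 B_2] [ZC C_1 /c2_eq1[lrC C_2]].
split; [exact: path3_of_hosoya | | exact: path4_of_hosoya].
(* A count of matchings is never zero, so [c2 B1 = 0] can only come from the factor
   [lbase B1 != rbase B1]. *)
have lrB : lbase B1 = rbase B1.
  apply/eqP; move: B_2; rewrite /c2; case: eqP => //= _; rewrite mul1n => B_2.
  by have := nmatch_gt0 ([set: B1] :\ lbase B1 :\ rbase B1); rewrite B_2.
(* With equal base points [c1 B1 = 2] is twice the number of matchings avoiding the base point. *)
apply: star4_of_hosoya => //; move: B_1; rewrite /c1 -lrB; lia.
Qed.
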